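(* Let $G$ be a split graph with vertex set partitioned as $I\cup C$, where $C=\{u_1,\ldots,u_k\}$ is a clique, $I=\{v_1,\ldots,v_t\}$ is an independent set, and no vertex of $I$ is adjacent to all vertices of $C$. Let $M(G)$ be the $k\times t$ $(0,1)$-matrix with entries $m_{ij}=1$ if and only if $u_i$ is adjacent to $v_j$. Then $G$ is semi-transitive if and only if the rows of $M(G)$ can be permuted in such a way that: (i) in every column, either the ones occupy consecutive rows or the zeroes occupy consecutive rows (circular ones property for all columns); and (ii) if some column has the form $1^a0^b1^c$ (read from top to bottom) with $a+b+c=k$ and $a,b,c\ge 1$, then no other column contains ones in all positions from $a$ to $a+b+1$.
   Context: A directed graph is semi-transitive if it is acyclic and for every directed path $w_1\to w_2\to\cdots\to w_s$ with $s\ge 2$, either there is no edge from $w_1$ to $w_s$, or all edges $w_i\to w_j$ exist for $1\le i<j\le s$. An undirected graph is semi-transitive if it admits an orientation that is semi-transitive. A split graph is a graph whose vertex set can be partitioned into a clique $C$ and an independent set $I$; here the clique is taken maximal in the sense that no vertex of $I$ is adjacent to all of $C$. *)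

(* Defs.v *)
From mathcomp Require Import all_boot perm matrix.

Set Implicit Arguments.
Unset Strict Implicit.
Unset Printing Implicit Defensive.

Section Graphs.
Variable T : finType.

Definition simple_graph (e : rel T) : Prop := symmetric e /\ irreflexive e.

(* [cycle d [:: x]] is [d x x], so loops and 2-cycles are excluded too. *)
Definition acyclic (d : rel T) : Prop :=
  forall c : seq T, cycle d c -> c = [::].

(* The directed path w_1 -> ... -> w_s is [x :: p]; its vertices are distinct
   as soon as [d] is acyclic, so [uniq] is not required. *)
Definition semi_transitive_digraph (d : rel T) : Prop :=
  acyclic d /\
  forall (x : T) (p : seq T), 2 <= size (x :: p) -> path d x p ->
    ~~ d x (last x p) \/ pairwise d (x :: p).

Definition orientation (e d : rel T) : Prop :=
  (forall x y, d x y -> e x y) /\ (forall x y, e x y -> d x y (+) d y x).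

Definition semi_transitive (e : rel T) : Prop :=
  exists d : rel T, orientation e d /\ semi_transitive_digraph d.

Definition clique (e : rel T) (C : {set T}) : Prop :=
  {in C &, forall x y, x != y -> e x y}.

Definition independent (e : rel T) (I : {set T}) : Prop :=
  {in I &, forall x y, ~~ e x y}.

Definition split_partition (e : rel T) (I C : {set T}) : Prop :=
  [/\ I :|: C = [set: T], [disjoint I & C], independent e I, clique e C
    & forall v, v \in I -> ~ (forall u, u \in C -> e u v)].

(* The entries 0 and 1 are encoded as [false] and [true]. *)
Definition split_matrix (e : rel T) (k t : nat)
    (u : 'I_k -> T) (v : 'I_t -> T) : 'M[bool]_(k, t) :=
  \matrix_(i < k, j < t) e (u i) (v j).

End Graphs.

Definition consecutive (k : nat) (P : pred 'I_k) : Prop :=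
  forall i j l : 'I_k, i <= j -> j <= l -> P i -> P l -> P j.

Definition circular_ones (k t : nat) (M : 'M[bool]_(k, t)) : Prop :=
  forall j : 'I_t,
    consecutive (fun i => M i j) \/ consecutive (fun i => ~~ M i j).

Definition column_word (k t : nat) (M : 'M[bool]_(k, t)) (j : 'I_t) : seq bool :=
  [seq M i j | i <- enum 'I_k].

(* Positions are numbered from 1, so row [i : 'I_k] is at position [i.+1]. *)
Definition no_covering_column (k t : nat) (M : 'M[bool]_(k, t)) : Prop :=
  forall (j : 'I_t) (a b c : nat),
    a + b + c = k -> 1 <= a -> 1 <= b -> 1 <= c ->
    column_word M j = nseq a true ++ nseq b false ++ nseq c true ->
    forall j' : 'I_t, j' != j ->
      ~ (forall i : 'I_k, a <= i.+1 <= a + b + 1 -> M i j').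

(* Main.v *)
Require Import Defs.
From mathcomp Require Import all_boot perm matrix.
From mathcomp Require Import zify.

(* Forward: a semi-transitive orientation orders the clique linearly as
   p_1 -> ... -> p_k, and shortcuts on four vertices show that a vertex of I
   either has only in- or only out-neighbours, which are then consecutive, or
   has in-neighbours forming an initial segment and out-neighbours forming a
   final one.
   Backward: give p_i height i, give a vertex of I height 0 (a source) when its
   ones are consecutive, and otherwise the height of a zero lying between two
   of its ones; orient every edge upwards. *)

Set Implicit Arguments.
Unset Strict Implicit.
Unset Printing Implicit Defensive.

(** * Circular columns and condition (ii) as a statement about triples of rows *)

Section Columns.
Variables (k t : nat) (M : 'M[bool]_(k, t)).

(** With rows counted from 0, the block of zeros of the word occupies rows [a] to [a + b - 1]. *)
Lemma column_wordP (j : 'I_t) (a b c : nat) : a + b + c = k ->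
  column_word M j = nseq a true ++ nseq b false ++ nseq c true <->
  forall i : 'I_k, M i j = ~~ (a <= i < a + b).
Proof.
move=> abc.
have nthL (i : 'I_k) : nth false (column_word M j) i = M i j.
  by rewrite (nth_map i) ?size_enum_ord // nth_ord_enum.
have nthR i : i < k ->
    nth false (nseq a true ++ nseq b false ++ nseq c true) i
    = ~~ (a <= i < a + b).
  move=> ik; rewrite !nth_cat !size_nseq !nth_nseq.
  case: (ltnP i a) => //= ai; have [ib|bi] := ltnP (i - a) b => /=; first by lia.
  have -> : i - a - b < c by lia.
  by lia.
split=> [w i | w].
  by rewrite -nthL w nthR.
apply: (@eq_from_nth _ false) => [|i].
  by rewrite size_map size_enum_ord !size_cat !size_nseq addnA abc.
rewrite size_map size_enum_ord => ik.
by rewrite nthR // (nthL (Ordinal ik)) w.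
Qed.

(** Condition (ii) freed from words: any pattern 1, 0, 1 in rows [i < m < l] counts, not only the
    tight one around the whole block of zeros. Both directions of the main proof handle such
    triples. *)
Definition no_covered_gap : Prop :=
  forall (j j' : 'I_t) (i m l : 'I_k), j' != j -> i < m -> m < l ->
    M i j -> ~~ M m j -> M l j ->
    ~ (forall r : 'I_k, i <= r <= l -> M r j').

Lemma no_covered_gapP :
  circular_ones M -> no_covering_column M <-> no_covered_gap.
Proof.
move=> circ; split=> [cov j j' i m l jj' im ml Mi Mm Ml all1 |
                      gap j a b c abc a0 b0 c0 w j' jj' all1].
- have [/(_ i m l (ltnW im) (ltnW ml) Mi Ml) | zeros] := circ j.
    by rewrite (negPf Mm).
  (* The zeros form the block from [z0] to [z1]. It lies strictly between [i] and [l], since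
     otherwise consecutiveness would put a zero at one of these two rows. *)
  have [z0 Mz0 minz] := @arg_minnP _ m (fun i => ~~ M i j) val Mm.
  have [z1 Mz1 maxz] := @arg_maxnP _ m (fun i => ~~ M i j) val Mm.
  have z0m := minz _ Mm; have mz1 := maxz _ Mm.
  have iz0 : i < z0.
    by rewrite ltnNge; apply/negP => /zeros/(_ (ltnW im) Mz0 Mm); rewrite Mi.
  have z1l : z1 < l.
    by rewrite ltnNge; apply/negP => /(zeros _ _ _ (ltnW ml))/(_ Mm Mz1); rewrite Ml.
  have lk := ltn_ord l.
  have abc : z0 + (z1.+1 - z0) + (k - z1.+1) = k by simpl in *; lia.
  apply: (cov j _ _ _ abc _ _ _ _ j' jj'); try by simpl in *; lia.
    apply/column_wordP => // r.
    have [Mr | Mr] := boolP (M r j).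
      apply/esym/negP => /andP[z0r rz1].
      have /(zeros _ _ _ z0r)/(_ Mz0 Mz1) : r <= z1 by lia.
      by rewrite Mr.
    have := minz _ Mr; have := maxz _ Mr; simpl in *; lia.
  by move=> r hr; apply: all1; simpl in *; lia.
- move/(column_wordP j abc) in w.
  (* The triple is the last one before the block, the first zero, and the first one after it;
     positions [a] to [a + b + 1] counted from 1 are rows [a - 1] to [a + b]. *)
  have ik : a.-1 < k by lia.
  have mk : a < k by lia.
  have lk : a + b < k by lia.
  apply: (gap j j' (Ordinal ik) (Ordinal mk) (Ordinal lk) jj');
    rewrite ?w /=; try lia.
  by move=> r hr; apply: all1; lia.
Qed.

End Columns.

(** * Consequences of a semi-transitive orientation on a transitively ordered clique *)

Section Forward.
Variables (T : finType) (e d : rel T).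
Hypotheses (he : simple_graph e) (hd : orientation e d).
Hypothesis (hst : semi_transitive_digraph d).

Lemma acyclic2 x y : d x y -> d y x -> False.
Proof. by move=> xy yx; have := hst.1 [:: x; y]; rewrite /= xy yx => /(_ isT). Qed.

Lemma acyclic3 x y z : d x y -> d y z -> d z x -> False.
Proof.
by move=> xy yz zx; have := hst.1 [:: x; y; z]; rewrite /= xy yz zx => /(_ isT).
Qed.

(** The only instance of the shortcut condition that the forward direction uses: paths on four
    vertices, keeping just the two diagonals. *)
Lemma shortcut4 x y z w :
  d x y -> d y z -> d z w -> d x w -> d x z /\ d y w.
Proof.
move=> xy yz zw xw; have := hst.2 x [:: y; z; w] isT.
rewrite /= xy yz zw xw => /(_ isT)[// |].
by case/and4P=> /and4P[_ -> _ _] /and3P[_ -> _] _ _.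
Qed.

Lemma orientation_edge x y : e x y -> d x y \/ d y x.
Proof. by move/hd.2; case: (d x y) => //=; [left | right]. Qed.

Variables (k : nat) (p : 'I_k -> T).
Hypothesis hp : forall i j : 'I_k, i < j -> d (p i) (p j).

Lemma in_before_out x (i l : 'I_k) : d (p i) x -> d x (p l) -> i < l.
Proof.
move=> ix xl; have [// | /hp li | /val_inj il] := ltngtP i l.
  by case: (acyclic3 li ix xl).
by rewrite il in ix; case: (acyclic2 ix xl).
Qed.

(** For [i' < i], the path [p i'], [p i], [x], [p l] is closed by the clique edge from [p i'] to
    [p l], so its diagonal from [p i'] to [x] exists. *)
Lemma in_initial x (i l i' : 'I_k) :
  d (p i) x -> d x (p l) -> i' <= i -> d (p i') x.
Proof.
move=> ix xl; rewrite leq_eqVlt => /predU1P[/val_inj -> // | ii'].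
by case: (shortcut4 (hp ii') ix xl (hp (ltn_trans ii' (in_before_out ix xl)))).
Qed.

Lemma out_final x (i l l' : 'I_k) :
  d (p i) x -> d x (p l) -> l <= l' -> d x (p l').
Proof.
move=> ix xl; rewrite leq_eqVlt => /predU1P[/val_inj <- // | ll'].
by case: (shortcut4 ix xl (hp ll') (hp (ltn_trans (in_before_out ix xl) ll'))).
Qed.

(** Each of the other three orientations of the two edges at [x] would force an edge between [x] and
    [p m]. *)
Lemma gap_in_out x (i m l : 'I_k) : i < m -> m < l ->
  e (p i) x -> ~~ e (p m) x -> e (p l) x -> d (p i) x /\ d x (p l).
Proof.
move=> im ml ei em el.
have noin : ~~ d (p m) x by apply: contra em => /hd.1.
have noout : ~~ d x (p m) by apply: contra em => /hd.1; rewrite he.1.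
have [ix | xi] := orientation_edge ei; have [lx | xl] := orientation_edge el => //.
- by case: (shortcut4 (hp im) (hp ml) lx ix) => _; rewrite (negPf noin).
- by move: noin; rewrite (in_initial lx xi (ltnW ml)).
- by case: (shortcut4 xi (hp im) (hp ml) xl); rewrite (negPf noout).
Qed.

(** If [x] has both in- and out-neighbours in the clique, these form an initial and a final segment,
    so the zeros are consecutive. Otherwise a gap is impossible by [gap_in_out], and the ones are
    consecutive. *)
Lemma circular_neighbours x :
  consecutive (fun i => e (p i) x) \/ consecutive (fun i => ~~ e (p i) x).
Proof.
have [/existsP[i /existsP[l /andP[ix xl]]] | no] :=
  boolP [exists i, exists l, d (p i) x && d x (p l)].
  right=> a b c ab bc ea ec; apply/negP => /orientation_edge[bx | xb].
    by case/negP: ea; apply: hd.1; exact: in_initial bx xl ab.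
  by case/negP: ec; rewrite he.1; apply: hd.1; exact: out_final ix xb bc.
left=> a b c; rewrite leq_eqVlt => /predU1P[/val_inj -> // | ab].
rewrite leq_eqVlt => /predU1P[/val_inj -> // | bc] ea ec; apply/negPn/negP => eb.
have [ax xc] := gap_in_out ab bc ea eb ec.
by case/negP: no; apply/existsP; exists a; apply/existsP; exists c; rewrite ax.
Qed.

(** The edges run from [p i] to [x] to [p l]. Any orientation at [y] other than [p i] to [y] to
    [p l] yields a directed triangle or an edge between [x] and [y]; in the remaining case the
    neighbours of [y] extend to both ends. The conclusion is full adjacency, which maximality of the
    clique will refute. *)
Lemma gap_not_covered x y (i m l : 'I_k) : ~~ e x y -> i < m -> m < l ->
  e (p i) x -> ~~ e (p m) x -> e (p l) x ->
  (forall r : 'I_k, i <= r <= l -> e (p r) y) -> forall r, e (p r) y.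
Proof.
move=> exy im ml ei em el cov r.
have [ix xl] := gap_in_out im ml ei em el.
have il : i < l := ltn_trans im ml.
have nxy : d x y -> False by move/hd.1; apply/negP.
have nyx : d y x -> False by move/hd.1; rewrite he.1; apply/negP.
have eiy : e (p i) y by apply: cov; rewrite leqnn ltnW.
have ely : e (p l) y by apply: cov; rewrite leqnn ltnW.
have [iy | yi] := orientation_edge eiy; have [ly | yl] := orientation_edge ely.
- by case: (shortcut4 ix xl ly iy) => _ /nxy.
- have [ri | ir] := leqP r i; first by apply: hd.1; apply: in_initial iy yl ri.
  have [lr | rl] := leqP l r; first by rewrite he.1; apply: hd.1; apply: out_final iy yl lr.
  by apply: cov; rewrite (ltnW ir) ltnW.
- by case: (acyclic3 (hp il) ly yi).
- by case: (shortcut4 yi ix xl yl) => /nyx.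
Qed.

End Forward.

(** * Linear order of an acyclic tournament *)

Lemma tournament_order (T : finType) (d : rel T) (k : nat) (u : 'I_k -> T) :
  (forall i j, i != j -> d (u i) (u j) || d (u j) (u i)) -> acyclic d ->
  exists s : 'S_k, forall i j : 'I_k, i < j -> d (u (s i)) (u (s j)).
Proof.
move=> tot acy.
have irr x : ~~ d x x.
  by apply/negP => xx; have := acy [:: x]; rewrite /= xx => /(_ isT).
have trans a b c : d (u a) (u b) -> d (u b) (u c) -> d (u a) (u c).
  move=> ab bc; have [ac | /tot/orP[// | ca]] := eqVneq a c.
    by have := acy [:: u a; u b]; rewrite /= ab ac bc => /(_ isT).
  by have := acy [:: u a; u b; u c]; rewrite /= ab bc ca => /(_ isT).
(* Vertices are ranked by in-degree within the tournament. By transitivity the rank strictly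
   increases along edges, so it is injective. *)
pose r i := #|[set j | d (u j) (u i)]|.
have rk i : r i < k.
  rewrite -[k in _ < k]card_ord -cardsT; apply: proper_card.
  by rewrite properT; apply/eqP => /setP/(_ i); rewrite !inE (negPf (irr _)).
have rmono i j : d (u i) (u j) -> r i < r j.
  move=> ij; apply: proper_card; apply/properP; split.
    by apply/subsetP => l; rewrite !inE => /trans; apply.
  by exists i; rewrite inE.
have rinj : injective (fun i => Ordinal (rk i)).
  move=> i j [rij]; apply/eqP/negPn/negP => /tot/orP[] /rmono;
  by rewrite rij ltnn.
(* The rank permutation sends a vertex to its position; its inverse lists the vertices by
   position. *)
exists (perm rinj)^-1%g => i j ij.
have rs a : r ((perm rinj)^-1%g a) = a.
  by have := permKV (perm rinj) a; rewrite permE => /(congr1 val).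
have /tot/orP[// | /rmono] : (perm rinj)^-1%g i != (perm rinj)^-1%g j.
  by rewrite (inj_eq perm_inj) -val_eqE neq_ltn ij.
by rewrite !rs ltnNge (ltnW ij).
Qed.

(** * The orientation by heights and its semi-transitivity *)

Section Backward.
Variables (T : finType) (e : rel T) (k : nat) (p : 'I_k -> T).
Hypotheses (he : simple_graph e) (pinj : injective p).

Definition gap (x : T) (m : 'I_k) : bool :=
  ~~ e (p m) x &&
  [exists i : 'I_k, exists l : 'I_k, [&& i < m, m < l, e (p i) x & e (p l) x]].

(** Clique heights start at 1, which leaves 0 for sources. A gap vertex ties with [p m] only, among
    clique vertices, and [p m] is not its neighbour; ties outside the clique are harmless because
    that part is independent. *)
Definition height (x : T) : nat :=
  if [pick i | p i == x] is Some i then i.+1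
  else if [pick m | gap x m] is Some m then m.+1 else 0.

Definition upward : rel T := fun x y => e x y && (height x < height y).

Hypothesis p_clique : forall i j, i != j -> e (p i) (p j).
Hypothesis indep : forall x y, x \notin codom p -> y \notin codom p -> ~~ e x y.
Hypothesis circ : forall x, x \notin codom p ->
  consecutive (fun i => e (p i) x) \/ consecutive (fun i => ~~ e (p i) x).
Hypothesis uncovered : forall x y (i m l : 'I_k),
  x \notin codom p -> y \notin codom p -> y != x -> i < m -> m < l ->
  e (p i) x -> ~~ e (p m) x -> e (p l) x ->
  ~ (forall r : 'I_k, i <= r <= l -> e (p r) y).

Lemma height_p i : height (p i) = i.+1.
Proof.
rewrite /height; case: pickP => [j /eqP/pinj -> // | /(_ i)].
by rewrite eqxx.
Qed.

Variant height_spec (x : T) : nat -> Prop :=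
| HeightSource of consecutive (fun i => e (p i) x) : height_spec x 0
| HeightGap (m i l : 'I_k) of consecutive (fun i => ~~ e (p i) x) &
    ~~ e (p m) x & i < m & m < l & e (p i) x & e (p l) x :
    height_spec x m.+1.

Lemma heightP x : x \notin codom p -> height_spec x (height x).
Proof.
move=> xp; rewrite /height; case: pickP => [i /eqP xi | _].
  by rewrite -xi codom_f in xp.
case: pickP => [m /andP[em /existsP[i /existsP[l /and4P[im ml ei el]]]] | nogap].
  case: (circ xp) => [/(_ i m l (ltnW im) (ltnW ml) ei el) | cz].
    by rewrite (negPf em).
  exact: (HeightGap cz em im ml ei el).
constructor=> a b c; rewrite leq_eqVlt => /predU1P[/val_inj -> // | ab].
rewrite leq_eqVlt => /predU1P[/val_inj -> // | bc] ea ec; apply/negPn/negP => eb.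
have := nogap b; rewrite /gap eb => /existsP[]; exists a.
by apply/existsP; exists c; rewrite ab bc ea.
Qed.

Lemma height_edge_neq i x : x \notin codom p -> e (p i) x ->
  height x != height (p i).
Proof.
rewrite height_p => /heightP[// | m _ _ _ em _ _ _ _].
by apply: contraL => /eqP[/val_inj <-].
Qed.

Lemma upward_orientation : orientation e upward.
Proof.
split=> [x y /andP[] // | x y exy].
have neq : height x != height y.
  have [/codomP[i xi] | xp] := boolP (x \in codom p); last first.
    have [/codomP[j yj] | yp] := boolP (y \in codom p); last first.
      by rewrite (negPf (indep xp yp)) in exy.
    by rewrite yj height_edge_neq // -yj he.1.
  have [/codomP[j yj] | yp] := boolP (y \in codom p); last first.
    by rewrite eq_sym xi height_edge_neq // -xi.
  rewrite xi yj !height_p eqSS; apply: contraTneq exy => /val_inj ij.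
  by rewrite xi yj ij he.2.
by rewrite /upward exy he.1 exy /=; move: neq; case: ltngtP.
Qed.

Lemma upward_acyclic : acyclic upward.
Proof.
case=> // x c /= cyc.
have : path (relpre height ltn) x (rcons c x).
  by apply: sub_path cyc => y z /andP[].
move/order_path_min => /(_ (fun _ _ _ => @ltn_trans _ _ _))/allP/(_ x).
by rewrite mem_rcons mem_head /= ltnn => /(_ isT).
Qed.

(** A zero at [j], together with the zero [m] above [i] that gives [x] its height, would make [i] a
    zero. A source cannot occur, as nothing lies below height 0. *)
Lemma upward_in_initial (i j : 'I_k) x : x \notin codom p ->
  upward (p i) x -> j <= i -> e (p j) x.
Proof.
move=> /heightP hx /andP[ei]; rewrite height_p.
case: hx => // m a b cz em _ _ _ _ im ji.
apply/negPn/negP => ej; have := cz j i m ji (ltnW im) ej em.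
by rewrite ei.
Qed.

Lemma upward_out_final (i j : 'I_k) x : x \notin codom p -> 0 < height x ->
  upward x (p i) -> i <= j -> e (p j) x.
Proof.
move=> /heightP hx x0 /andP[]; rewrite he.1 => ei; rewrite height_p.
case: hx x0 => // m a b cz em _ _ _ _ _ mi ij.
apply/negPn/negP => ej; have := cz m i j (ltnW mi) ij em ej.
by rewrite ei.
Qed.

(** The gap of [x] ends at or before row [i], while [y] is adjacent to every row up to [j], so [y]
    would cover that gap. *)
Lemma no_out_in x y (i j : 'I_k) : x \notin codom p -> y \notin codom p ->
  0 < height x -> upward x (p i) -> upward (p j) y -> i <= j -> False.
Proof.
move=> xp yp x0 xi jy ij.
have hxy : height x < height y.
  case/andP: xi => _ xi; case/andP: jy => _ jy.
  by rewrite !height_p in xi jy; lia.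
have yx : y != x by apply: contraTneq hxy => ->; rewrite ltnn.
case/andP: (xi) => exi; rewrite he.1 in exi; rewrite height_p => hxi.
case: (heightP xp) x0 hxi => // m a b _ em am mb ea _ _ mi.
apply: (uncovered xp yp yx am mi ea em exi) => r /andP[_ ri].
exact: upward_in_initial jy (leq_trans ri ij).
Qed.

Lemma source_interval x (i j l : 'I_k) : x \notin codom p -> height x = 0 ->
  e (p i) x -> e (p l) x -> i <= j -> j <= l -> e (p j) x.
Proof.
by move=> /heightP hx x0 ei el ij jl; case: hx x0 => // cx _; apply: cx ei el.
Qed.

(** The height of [y] marks a zero between its ones [j] and [l], and the interval of neighbours of
    the source [x] would cover this gap. *)
Lemma source_no_in_out x y (i j l r : 'I_k) : x \notin codom p -> y \notin codom p ->
  height x = 0 -> e (p i) x -> e (p r) x -> upward (p j) y -> upward y (p l) ->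
  i <= j -> l <= r -> False.
Proof.
move=> xp yp x0 ei er /andP[ejy hjy] /andP[eyl hyl] ij lr.
rewrite he.1 in eyl; rewrite !height_p in hjy hyl.
have xy : x != y by apply: contraTneq hjy => <-; rewrite x0.
case: (heightP yp) hjy hyl => // m a b _ em _ _ _ _ jm ml.
apply: (uncovered yp xp xy jm ml ejy em eyl) => c /andP[jc cl].
exact: source_interval x0 ei er (leq_trans ij jc) (leq_trans cl lr).
Qed.

Lemma upward_semi_transitive : semi_transitive_digraph upward.
Proof.
split; first exact: upward_acyclic.
move=> x q _ pth; have [dxl | ndxl] := boolP (upward x (last x q)); last by left.
right; set w := x :: q in pth *.
pose n := size q; pose W a := nth x w a.
have sz : size w = n.+1 by [].
have step a : a < n -> upward (W a) (W a.+1) by move=> an; exact: (pathP x pth).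
have mono a b : a < b -> b <= n -> height (W a) < height (W b).
  elim: b => // b IH; rewrite ltnS leq_eqVlt => /predU1P[-> | ab] bn.
    by case/andP: (step _ bn).
  by apply: ltn_trans (IH ab (ltnW bn)) _; case/andP: (step _ bn).
have last_edge : upward (W 0) (W n) by rewrite /W nth_last.
have pos a : 0 < a -> a <= n -> 0 < height (W a).
  by move=> a0 an; apply: leq_ltn_trans (mono 0 a a0 an).
have source a : a <= n -> height (W a) = 0 -> a = 0.
  by case: a => // a an ha; have := pos _ (ltn0Sn a) an; rewrite ha.
have nbr a b : upward (W a) (W b) ->
    (W a \notin codom p -> exists i, W b = p i) /\
    (W b \notin codom p -> exists i, W a = p i).
  case/andP=> eab _; split=> np.
    have [/codomP // | np'] := boolP (W b \in codom p).
    by rewrite (negPf (indep np np')) in eab.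
  have [/codomP // | np'] := boolP (W a \in codom p).
  by rewrite (negPf (indep np' np)) in eab.
have le_p a b i j : a <= b -> b <= n -> W a = p i -> W b = p j -> i <= j.
  rewrite leq_eqVlt => /predU1P[-> _ -> /pinj -> // | ab bn ai bj].
  by have := mono a b ab bn; rewrite ai bj !height_p ltnS => /ltnW.
apply/(pairwiseP x) => a b; rewrite !inE !sz !ltnS => an bn ab.
(* Heights increase along the path, so only adjacency of [W a] and [W b] is left; the cases are
   whether each lies in the clique. *)
rewrite -!/(W _) /upward mono // andbT.
have stepb : upward (W b.-1) (W b) by case: b bn ab => // b bn _; exact: step.
have stepa := step a (leq_trans ab bn).
have [/codomP[i ai] | ap] := boolP (W a \in codom p);
  have [/codomP[j bj] | bp] := boolP (W b \in codom p).
- rewrite ai bj; apply: p_clique; have := mono a b ab bn.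
  by rewrite ai bj !height_p; apply: contraTneq => ->; rewrite ltnn.
(* The predecessor of [W b] on the path is a clique vertex not below [W a], so the initial segment
   of in-neighbours of [W b] reaches [W a]. *)
- have [i' bi'] := (nbr _ _ stepb).2 bp; rewrite bi' in stepb.
  rewrite ai; apply: upward_in_initial stepb _ => //.
  by apply: (le_p a b.-1) => //; lia.
- have [i' ai'] := (nbr _ _ stepa).1 ap; rewrite ai' in stepa.
  have i'j : i' <= j by apply: (le_p a.+1 b).
  (* A source can only start the path; then [W b] lies between its neighbours [W 1] and [W n], and
     its ones are an interval. A gap vertex instead has a final segment of out-neighbours. *)
  rewrite bj he.1; have [a0 | apos] := posnP (height (W a)).
    have za := source a an a0; rewrite za in ap a0 stepa *.
    have [l nl] := (nbr _ _ last_edge).1 ap.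
    rewrite nl in last_edge; case/andP: last_edge => el _.
    case/andP: stepa => ei' _; rewrite he.1 in el; rewrite he.1 in ei'.
    by apply: source_interval ap a0 ei' el i'j (le_p b n _ _ _ _ _ _).
  exact: upward_out_final stepa i'j.
- have [i' ai'] := (nbr _ _ stepa).1 ap; have [j' bj'] := (nbr _ _ stepb).2 bp.
  rewrite ai' in stepa; rewrite bj' in stepb.
  have ab1 : a.+1 <= b.-1.
    rewrite leqNgt; apply/negP => ?; have ab' : b = a.+1 by lia.
    by move: bp; rewrite ab' ai' codom_f.
  have i'j' : i' <= j' by apply: (le_p a.+1 b.-1) => //; lia.
  (* Two vertices outside the clique cannot both be on the path. If [W a] is a source, then [a = 0],
     the edge to [W n] puts [W n] in the clique, hence [b < n], and both path neighbours of [W b]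
     lie within the interval of the source. *)
  exfalso; have [a0 | apos] := posnP (height (W a)); last first.
    by case: (no_out_in ap bp apos stepa stepb i'j').
  have za := source a an a0; rewrite za in ap a0 stepa.
  have [l nl] := (nbr _ _ last_edge).1 ap.
  have bltn : b < n.
    rewrite ltn_neqAle bn andbT; apply: contraNneq bp => ->.
    by rewrite nl codom_f.
  have stepb' := step b bltn; have [r br] := (nbr _ _ stepb').1 bp.
  rewrite nl in last_edge; case/andP: last_edge => el _.
  case/andP: stepa => ei' _; rewrite he.1 in el; rewrite he.1 in ei'.
  rewrite br in stepb'.
  by case: (source_no_in_out ap bp a0 ei' el stepb stepb' i'j' (le_p b.+1 n _ _ _ _ _ _)).
Qed.

End Backward.

(** * Translation between the permuted matrix and the ordered clique *)

Theorem theorem2 (T : finType) (e : rel T) (I C : {set T}) (k t : nat)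
    (u : 'I_k -> T) (v : 'I_t -> T)
    (he : simple_graph e)
    (hsplit : split_partition e I C)
    (hu : injective u) (hC : C = [set u i | i : 'I_k])
    (hv : injective v) (hI : I = [set v j | j : 'I_t]) :
  semi_transitive e <->
  exists s : 'S_k,
    circular_ones (row_perm s (split_matrix e u v)) /\
    no_covering_column (row_perm s (split_matrix e u v)).
Proof.
case: hsplit => IC dis ind cl maxC.
have uC i : u i \in C by rewrite hC imset_f.
have vI j : v j \in I by rewrite hI imset_f.
have ME (s : 'S_k) i j :
    row_perm s (split_matrix e u v) i j = e (u (s i)) (v j) by rewrite !mxE.
split=> [[d [hd hst]] | [s [circ cov]]].
- have [||s hs] := @tournament_order T d k u; [|exact: hst.1|].
    move=> i j ij; have := hd.2 (u i) (u j) (cl _ _ (uC i) (uC j) _).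
    by rewrite (inj_eq hu) => /(_ ij); case: (d _ _) => //= ->.
  exists s.
  have circ : circular_ones (row_perm s (split_matrix e u v)).
    move=> j; case: (circular_neighbours he hd hst hs (v j)) => co.
      by left=> a b c ab bc; rewrite !ME; apply: co.
    by right=> a b c ab bc; rewrite !ME; apply: co.
  split=> //; apply/no_covered_gapP => // j j' i m l jj' im ml.
  (* A column covering a gap would belong to a vertex adjacent to all of [C], against the maximality
     of the clique. *)
  rewrite !ME => ei em el all1; apply: (maxC (v j')) => // x.
  rewrite hC => /imsetP[r _ ->]; rewrite -(permKV s r).
  apply: (gap_not_covered he hd hst hs _ im ml ei em el) => [|c hc].
    exact: ind.
  by rewrite -ME; apply: all1.
- move/(no_covered_gapP circ) in cov.
  pose p i := u (s i).
  have notp x : x \notin codom p -> exists j, x = v j.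
    move=> xp; have : x \in I :|: C by rewrite IC inE.
    rewrite inE => /orP[|]; first by rewrite hI => /imsetP[j _ ->]; exists j.
    rewrite hC => /imsetP[i _ xi]; case/negP: xp; apply/codomP.
    by exists (s^-1%g i); rewrite /p permKV.
  have pinj : injective p by move=> i j /hu/perm_inj.
  have p_clique i j : i != j -> e (p i) (p j).
    by move=> ij; apply: cl; rewrite ?uC // (inj_eq pinj).
  have indep x y : x \notin codom p -> y \notin codom p -> ~~ e x y.
    by move=> /notp[j ->] /notp[j' ->]; apply: ind.
  have hcirc x : x \notin codom p ->
      consecutive (fun i => e (p i) x) \/ consecutive (fun i => ~~ e (p i) x).
    move=> /notp[j ->]; case: (circ j) => co; [left | right] => a b c ab bc;
    by have := co a b c ab bc; rewrite !ME.
  exists (upward e p); split; first exact: upward_orientation.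
  apply: upward_semi_transitive => // x y i m l /notp[j ->] /notp[j' ->] jj' im ml.
  move=> ei em el all1; apply: (cov j j' i m l); rewrite ?ME //.
    by apply: contraNneq jj' => ->.
  by move=> r hr; rewrite ME; apply: all1.
Qed.
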